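(* For every integer $n\geq 0$, $$\sum_{\iota\in\mathcal{I}_n(213)} q^{\mathrm{maj}(\iota)} \;=\; q^{\binom{n}{2}}\sum_{\iota\in\mathcal{I}_n(132)} q^{-\mathrm{maj}(\iota)}.$$
   Context: $\mathfrak{S}_n$ is the set of permutations of $[n]=\{1,\dots,n\}$, written in one-line notation $\sigma(1)\sigma(2)\cdots\sigma(n)$ ($\mathfrak{S}_0$ contains only the empty permutation). A permutation $\sigma\in\mathfrak{S}_n$ contains a pattern $\pi\in\mathfrak{S}_k$ if there are indices $m_1<\dots<m_k$ such that $\sigma(m_1)\cdots\sigma(m_k)$ is in the same relative order as $\pi(1)\cdots\pi(k)$; otherwise $\sigma$ avoids $\pi$. An involution is a permutation $\iota$ with $\iota^2=\mathrm{id}$; $\mathcal{I}_n(\pi)$ is the set of involutions in $\mathfrak{S}_n$ avoiding $\pi$. The descent set is $\mathrm{Des}(\sigma)=\{i\in[n-1]:\sigma(i)>\sigma(i+1)\}$ and the major index is $\mathrm{maj}(\sigma)=\sum_{i\in\mathrm{Des}(\sigma)} i$. *)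

(* Defs.v *)
From HB Require Import structures.
From mathcomp Require Import all_boot all_order all_algebra all_fingroup.

Set Implicit Arguments.
Unset Strict Implicit.
Unset Printing Implicit Defensive.

Import GRing.Theory.

(* Permutations of [n] are 'S_n, acting on 'I_n = {0, ..., n-1}: positions    *)
(* and values are both shifted down by one.                                   *)

Definition contains n k (s : 'S_n) (p : 'S_k) : bool :=
  [exists m : {ffun 'I_k -> 'I_n},
    [forall i : 'I_k, forall j : 'I_k, (i < j) ==> (m i < m j)] &&
    [forall i : 'I_k, forall j : 'I_k, (s (m i) < s (m j)) == (p i < p j)]].

Definition avoids n k (s : 'S_n) (p : 'S_k) : bool := ~~ contains s p.

Definition p213 : 'S_3 := tperm (inord 0) (inord 1).
Definition p132 : 'S_3 := tperm (inord 1) (inord 2).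

Definition one_line n (s : 'S_n) : seq nat := [seq (s i).+1 | i <- enum 'I_n].

Lemma one_line_p213 : one_line p213 = [:: 2; 1; 3].
Proof.
rewrite /one_line !enum_ordSl (size0nil (size_enum_ord 0)) /= /p213.
by rewrite !permE /= -!val_eqE /= !inordK.
Qed.

Lemma one_line_p132 : one_line p132 = [:: 1; 3; 2].
Proof.
rewrite /one_line !enum_ordSl (size0nil (size_enum_ord 0)) /= /p132.
by rewrite !permE /= -!val_eqE /= !inordK.
Qed.

Definition invol_avoiding n k (p : 'S_k) : {set 'S_n} :=
  [set s : 'S_n | (s * s == 1)%g && avoids s p].

Definition Des n (s : 'S_n) : {set 'I_n} :=
  [set i : 'I_n | [exists j : 'I_n, (j == i.+1 :> nat) && (s j < s i)]].

(* The 0-based index i : 'I_n is the position i + 1 of [n]. *)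
Definition maj n (s : 'S_n) : nat := \sum_(i in Des s) i.+1.

(* The formal variable q, in Q(q) = Frac(Z[q]), which contains Z[q, q^-1]. *)
Definition q : {fraction {poly int}} := tofrac 'X%R.

(* Main.v *)
Require Import Defs.
From mathcomp Require Import all_boot all_order all_algebra all_fingroup.
From mathcomp Require Import zify.

Set Implicit Arguments.
Unset Strict Implicit.
Unset Printing Implicit Defensive.

Import GRing.Theory.

(** In a 132-avoiding permutation [i] is a descent exactly when [i + 1] is the
    position of a left-to-right minimum, and the permutation is determined by
    its prefix minima. For an involution the left-to-right minima are symmetric
    about the diagonal, so, with [D] the descent set and [c i] the number of
    descents below [i], the prefix minimum at [i] is at most [v] iff
    [#|D| <= c i + c v]. Hence the descent set determines the involution, and
    the descent sets that occur are those with [#|D| <= c i + c (n - i)] for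
    all [i] (for permutations of [n + 1] letters). This family is stable under
    reversing and complementing [D]; since reverse-complement exchanges the
    patterns 132 and 213 and reverses the descent set, the identity follows. *)

(** * Avoidance of patterns of length three *)

Definition has_triple n (r : nat -> nat -> nat -> bool) (s : 'S_n) : Prop :=
  exists a b c : 'I_n, [/\ a < b, b < c & r (s a) (s b) (s c)].

Lemma forall_I3 (P : pred 'I_3) :
  [forall i, P i] = [&& P (inord 0), P (inord 1) & P (inord 2)].
Proof.
apply/forallP/and3P => [h | [h0 h1 h2] i]; first by split.
rewrite -(inord_val i); case: i => [[|[|[|i]]] hi] //=.
Qed.

Lemma containsP n (s : 'S_n) (p : 'S_3) :
  reflect (has_triple (fun x y z =>
     [&& (x < y) == (p (inord 0) < p (inord 1)),
         (y < x) == (p (inord 1) < p (inord 0)),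
         (x < z) == (p (inord 0) < p (inord 2)),
         (z < x) == (p (inord 2) < p (inord 0)),
         (y < z) == (p (inord 1) < p (inord 2)) &
         (z < y) == (p (inord 2) < p (inord 1))]) s) (contains s p).
Proof.
apply: (iffP existsP) => [[m]|[a [b [c [ab bc h]]]]].
  rewrite !forall_I3 !inordK //.
  case/andP=> /and3P[/and3P[_ m01 _] /and3P[_ _ m12] _].
  case/and3P=> /and3P[_ h1 h2] /and3P[h3 _ h4] /and3P[h5 h6 _].
  exists (m (inord 0)), (m (inord 1)), (m (inord 2)); split=> //.
  by rewrite h1 h2 h3 h4 h5 h6.
exists [ffun i : 'I_3 => nth a [:: a; b; c] i].
rewrite !forall_I3 !ffunE !inordK //= !ltnn !eqxx /=.
rewrite ab bc (ltn_trans ab bc) /=.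
by case/and5P: h => -> -> -> -> /andP[-> ->].
Qed.

Lemma avoids132P n (s : 'S_n) :
  reflect (forall a b c : 'I_n, a < b -> b < c -> s a < s c -> s c < s b -> False)
          (avoids s p132).
Proof.
apply: (iffP idP) => [/containsP h a b c ab bc ac cb | h].
  apply: h; exists a, b, c; split=> //.
  by rewrite /p132 !permE /= -!val_eqE /= !inordK //=; lia.
apply/containsP => -[a [b [c [ab bc]]]].
rewrite /p132 !permE /= -!val_eqE /= !inordK //= => H.
by apply: (h a b c ab bc); lia.
Qed.

Lemma avoids213P n (s : 'S_n) :
  reflect (forall a b c : 'I_n, a < b -> b < c -> s b < s a -> s a < s c -> False)
          (avoids s p213).
Proof.
apply: (iffP idP) => [/containsP h a b c ab bc ac cb | h].
  apply: h; exists a, b, c; split=> //.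
  by rewrite /p213 !permE /= -!val_eqE /= !inordK //=; lia.
apply/containsP => -[a [b [c [ab bc]]]].
rewrite /p213 !permE /= -!val_eqE /= !inordK //= => H.
by apply: (h a b c ab bc); lia.
Qed.

Lemma involP n (s : 'S_n) : reflect (involutive s) (s * s == 1)%g.
Proof.
apply: (iffP eqP) => [h i | h]; first by rewrite -permM h perm1.
by apply/permP => i; rewrite permM perm1 h.
Qed.

(** * Prefix minima determine a 132-avoiding permutation *)

(** Prefix minima are kept as a relation between positions and values, so that inversion merely
    swaps [i] and [v]. *)
Definition below n (s : 'S_n) (i v : nat) : bool :=
  [exists j : 'I_n, (j <= i) && (s j <= v)].

Lemma below_inv n (s : 'S_n) i v : below s^-1 i v = below s v i.
Proof.
apply/existsP/existsP => -[j /andP[h1 h2]].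
  by exists (s^-1 j)%g; rewrite permKV h1 h2.
by exists (s j); rewrite permK h1 h2.
Qed.

Lemma avoids132_inv n (s : 'S_n) : avoids s p132 -> avoids s^-1%g p132.
Proof.
move/avoids132P=> h; apply/avoids132P => a b c ab bc ac cb.
by apply: (h (s^-1 a) (s^-1 c) (s^-1 b))%g; rewrite ?permKV.
Qed.

(** If [s k < t k], then [t] takes the value [s k] at some [c] after [k], while equal prefix minima
    give [j < k] with [t j < s k]. Then [j], [k], [c] form a 132 in [t]. *)
Lemma avoids132_below_le n (s t : 'S_n) (k : 'I_n) :
    avoids t p132 -> (forall i v : 'I_n, below s i v = below t i v) ->
    (forall j : 'I_n, j < k -> s j = t j) -> t k <= s k.
Proof.
move=> /avoids132P tA eq_st eq_lt; rewrite leqNgt; apply/negP => lt_k.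
set c := (t^-1 (s k))%g.
have tc : t c = s k by rewrite permKV.
have k_c : k < c.
  rewrite ltnNge leq_eqVlt; apply/negP => /orP[/eqP/val_inj ck|ck].
    by move: lt_k; rewrite -tc ck ltnn.
  have /perm_inj ekc : s k = s c by rewrite -tc eq_lt.
  by rewrite ekc ltnn in ck.
have : below t k (s k).
  by rewrite -eq_st; apply/existsP; exists k; rewrite !leqnn.
case/existsP=> j /andP[jk tj].
have j_ltk : j < k.
  by rewrite ltn_neqAle jk andbT; apply: contraTneq tj => /val_inj ->; rewrite -ltnNge.
apply: (tA j k c) => //; rewrite tc // ltn_neqAle tj andbT.
apply/eqP => /val_inj tjs; have jc : j = c by apply: (@perm_inj _ t); rewrite tc.
by move: k_c; rewrite -jc ltnNge jk.
Qed.

Lemma avoids132_below_inj n (s t : 'S_n) :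
    avoids s p132 -> avoids t p132 ->
    (forall i v : 'I_n, below s i v = below t i v) -> s = t.
Proof.
move=> sA tA eq_st.
suff H m : forall k : 'I_n, k < m -> s k = t k.
  by apply/permP => k; apply: (H k.+1).
elim: m => // m IH k; rewrite ltnS => km.
have eq_lt (j : 'I_n) : j < k -> s j = t j by move=> jk; apply: IH; lia.
apply/val_inj/eqP; rewrite eqn_leq; apply/andP; split.
  by apply: avoids132_below_le => // j /eq_lt.
exact: avoids132_below_le.
Qed.

(** * Descents and left-to-right minima *)

(** The last position is never a descent; indexing by ['I_n] lets reversal and complement act on
    descent sets. *)
Definition desc n (s : 'S_n.+1) : {set 'I_n} :=
  [set i : 'I_n | s (lift ord0 i) < s (widen_ord (leqnSn n) i)].

Definition cnt n (D : {set 'I_n}) (i : nat) : nat := #|[set x in D | x < i]|.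

Definition lrmin n (s : 'S_n) : {set 'I_n} :=
  [set p : 'I_n | [forall j : 'I_n, (j < p) ==> (s p < s j)]].

Lemma lrminP n (s : 'S_n) (p : 'I_n) :
  reflect (forall j : 'I_n, j < p -> s p < s j) (p \in lrmin s).
Proof. by rewrite inE; apply: (iffP forallP) => h j; apply/implyP/h. Qed.

(** After a descent at [i], an earlier value below [s (i + 1)] would form a 132 with positions [i]
    and [i + 1]. *)
Lemma lrmin_lift n (s : 'S_n.+1) (i : 'I_n) :
  avoids s p132 -> (lift ord0 i \in lrmin s) = (i \in desc s).
Proof.
move=> /avoids132P sA; rewrite [RHS]inE; apply/lrminP/idP => [|di j].
  by apply; rewrite /= /bump /=.
rewrite /= /bump /= add1n ltnS => ji; rewrite ltnNge; apply/negP => sj.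
have ne_j : j != lift ord0 i by rewrite -val_eqE /= /bump /=; lia.
have sj' : s j < s (lift ord0 i).
  by rewrite ltn_neqAle sj andbT val_eqE (inj_eq perm_inj).
apply: (sA j (widen_ord (leqnSn n) i) (lift ord0 i)) => //=.
rewrite ltn_neqAle ji andbT; apply/eqP => eji.
have ej : j = widen_ord (leqnSn n) i by apply: val_inj.
by move: sj' di; rewrite ej; lia.
Qed.

Lemma card_lrmin_le n (s : 'S_n.+1) (i : nat) : avoids s p132 ->
  #|[set p in lrmin s | p <= i]| = (cnt (desc s) i).+1.
Proof.
move=> sA.
have -> : [set p in lrmin s | p <= i] =
    ord0 |: [set lift ord0 x | x in [set x in desc s | x < i]].
  apply/setP => p; rewrite in_setU1 inE.
  have [j ->|->] := unliftP ord0 p.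
    rewrite lrmin_lift // [_ == ord0]eq_sym (negPf (neq_lift ord0 j)) /=.
    by rewrite mem_imset ?inE; last exact: lift_inj.
  by rewrite eqxx leq0n andbT; apply/lrminP.
rewrite cardsU1 card_imset; last exact: lift_inj.
by rewrite (_ : ord0 \notin _) //; apply/imsetP => -[x _ /eqP]; apply/negP/neq_lift.
Qed.

Lemma cnt_full n (D : {set 'I_n}) i : n <= i -> cnt D i = #|D|.
Proof.
move=> ni; apply: eq_card => x; rewrite inE andbC.
by rewrite (leq_trans (ltn_ord x) ni).
Qed.

Lemma lrmin_invol n (s : 'S_n) p :
  involutive s -> (s p \in lrmin s) = (p \in lrmin s).
Proof.
move=> sK; suff H r : r \in lrmin s -> s r \in lrmin s.
  by apply/idP/idP => /H //; rewrite sK.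
move=> /lrminP h; apply/lrminP => j jsr; rewrite sK ltnNge leq_eqVlt.
apply/negP => /orP[/eqP/val_inj e|/h].
  by move: jsr; rewrite -e sK ltnn.
by rewrite sK ltnNge ltnW.
Qed.

(* The left-to-right minima form a decreasing chain, symmetric under the      *)
(* involution: those in positions <= i and those with values <= v overlap     *)
(* exactly when the prefix minimum at i is at most v.                         *)
Lemma below_invol132 n (s : 'S_n.+1) (i v : nat) :
    involutive s -> avoids s p132 ->
  below s i v = (#|desc s| <= cnt (desc s) i + cnt (desc s) v).
Proof.
move=> sK sA; set A := [set p in lrmin s | p <= i].
set C := [set p in lrmin s | s p <= v].
have cA : #|A| = (cnt (desc s) i).+1 by apply: card_lrmin_le.
(* [s] maps [C] onto the left-to-right minima in positions at most [v]. *)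
have cC : #|C| = (cnt (desc s) v).+1.
  rewrite -(card_lrmin_le _ sA) -(card_imset _ (@perm_inj _ s)).
  apply: eq_card => p; rewrite inE; apply/imsetP/andP => [[r]|[pm pv]].
    by rewrite inE => /andP[rm rv] ->; rewrite lrmin_invol.
  by exists (s p); rewrite ?sK // [_ \in C]inE lrmin_invol ?sK ?pm.
have cM : #|lrmin s| = #|desc s|.+1.
  rewrite -(@cnt_full _ (desc s) n) // -(card_lrmin_le _ sA).
  apply: eq_card => p; rewrite [RHS]inE; have -> : p <= n by rewrite -ltnS.
  by rewrite andbT.
have := cardsUI A C; rewrite cA cC => cUI.
have sub : A :|: C \subset lrmin s.
  by apply/subsetP => p; rewrite !inE => /orP[]/andP[].
apply/existsP/idP => [[j0 /andP[j0i j0v]] | le_d].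
  have [j ji jmin] : exists2 j : 'I_n.+1, j <= i &
      forall x : 'I_n.+1, x <= i -> s j <= s x.
    case: (@arg_minnP _ j0 (fun x : 'I_n.+1 => x <= i) (fun x => s x : nat)) => // x.
    by exists x.
  have jv : s j <= v := leq_trans (jmin _ j0i) j0v.
  have jM : j \in lrmin s.
    apply/lrminP => x xj; rewrite ltn_neqAle jmin ?andbT; last by lia.
    rewrite val_eqE (inj_eq perm_inj); apply/eqP => ejx.
    by rewrite ejx ltnn in xj.
  have ncap : 0 < #|A :&: C|.
    apply/card_gt0P; exists j.
    by rewrite in_setI [_ \in A]inE [_ \in C]inE jM ji jv.
  (* A left-to-right minimum after position [i] has a value below [s j], hence at most [v]. *)
  have scup : lrmin s \subset A :|: C.
    apply/subsetP => p pM; rewrite in_setU [_ \in A]inE [_ \in C]inE pM /=.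
    have [//|ip] := leqP p i; move/lrminP: pM => /(_ j) pj.
    by have := pj (leq_ltn_trans ji ip); lia.
  by move: (subset_leq_card sub) (subset_leq_card scup); lia.
(* Here the sizes of [A] and [C] add up to more than the number of left-to-right minima. *)
have /card_gt0P[p] : 0 < #|A :&: C| by move: (subset_leq_card sub); lia.
rewrite in_setI [_ \in A]inE [_ \in C]inE.
by case/andP=> /andP[_ pi] /andP[_ pv]; exists p; rewrite pi pv.
Qed.

(** * Greedy construction from prescribed prefix minima *)

Lemma fresh_above (l : seq nat) a : exists v, (a <= v) && (v \notin l).
Proof.
exists (a + \max_(x <- l) x.+1); rewrite leq_addr /=.
apply/negP => /(@leq_bigmax_seq _ _ xpredT succn) /(_ isT).
by rewrite ltnNge leq_addl.
Qed.

Lemma fresh_above_le (l : seq nat) a v :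
  (forall w, a <= w -> w \notin l -> v <= w) -> v <= a + size l.
Proof.
move=> vmin; rewrite leqNgt; apply/negP => lt_v.
have : size (iota a (size l).+1) <= size l.
  apply: uniq_leq_size; first exact: iota_uniq.
  move=> w; rewrite mem_iota => /andP[aw wl]; apply/negPn/negP => /(vmin _ aw).
  by lia.
by rewrite size_iota ltnn.
Qed.

(** Only [k] values are taken before step [k], so a free one exists between [m k] and [m k + k].
    This bound later keeps the values below [n]. *)
Lemma greedy_sequence (m : nat -> nat) :
  exists f : nat -> nat, forall k,
  [/\ m k <= f k <= m k + k,
      forall j, j < k -> f j <> f k
    & forall w, m k <= w -> (forall j, j < k -> f j <> w) -> f k <= w].
Proof.
pose next k l := ex_minn (fresh_above l (m k)).
pose g := fix g k := if k is k'.+1 then rcons (g k') (next k' (g k')) else [::].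
pose f k := next k (g k).
have gE k : g k = mkseq f k by elim: k => // k IH; rewrite mkseqS -IH.
have gP k x : reflect (exists2 j, j < k & f j = x) (x \in g k).
  rewrite gE; apply: (iffP mapP) => -[j].
    by rewrite mem_iota => jk ->; exists j.
  by move=> jk <-; exists j; rewrite ?mem_iota.
exists f => k; have := erefl (f k); rewrite {1}/f /next.
case: ex_minnP => v /andP[mv vg] vmin ev; rewrite -ev.
have {}vmin w : m k <= w -> w \notin g k -> v <= w.
  by move=> mw wg; apply: vmin; rewrite mw wg.
split=> [|j jk ejv|w mw wf].
- rewrite mv /=; have := fresh_above_le vmin.
  by rewrite gE size_mkseq.
- by case/negP: vg; apply/gP; exists j.
- by apply: vmin => //; apply/gP => -[j /wf].
Qed.

(* Greedy choice: at each position take the least unused value that is at     *)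
(* least the prescribed prefix minimum.                                       *)
Lemma prefix_min_perm n (m : nat -> nat) :
    (forall i j, i <= j -> m j <= m i) -> (forall i, i < n -> i + m i < n) ->
  exists s : 'S_n,
  [/\ avoids s p132,
      forall (i : 'I_n) v, below s i v = (m i <= v)
    & forall i j : 'I_n, j = i.+1 :> nat -> (s j < s i) = (m j < m i)].
Proof.
move=> m_anti m_bound; have [f fP] := greedy_sequence m.
have f_lt (i : 'I_n) : f i < n.
  by have [/andP[_ h] _ _] := fP i; have := m_bound i (ltn_ord i); lia.
have f_neq i j : i < j -> f i <> f j by move=> ij; have [_ h _] := fP j; apply: h.
have f_inj : injective (fun i : 'I_n => Ordinal (f_lt i)).
  move=> i j /(congr1 val) /= e; apply/val_inj => /=.
  by have [/f_neq|/f_neq|] := ltngtP i j; rewrite ?e.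
have f_ge i j : i <= j -> m j <= f i.
  by move=> ij; have [/andP[h _] _ _] := fP i; apply: leq_trans h; apply: m_anti.
(* The value [f j] was still free at step [i]. *)
have f_min i j : i <= j -> m i <= f j -> f i <= f j.
  move=> ij mij; have [_ _ h] := fP i; apply: h => // x xi.
  by apply: f_neq; lia.
exists (perm f_inj); split=> [|i v|i j ij].
- apply/avoids132P => a b c ab bc; rewrite !permE /= => ac cb.
  by have := f_min b c (ltnW bc); have := f_ge a b (ltnW ab); lia.
- apply/existsP/idP => [[j /andP[ji]]|mi].
    by rewrite permE /=; have := f_ge j i ji; lia.
  (* Either the value [m i] was used before step [i], or it is chosen there. *)
  have [/existsP[j /andP[ji /eqP fj]]|nex] :=
      boolP [exists j : 'I_n, (j < i) && (f j == m i)].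
    by exists j; rewrite permE /= fj mi ltnW.
  exists i; rewrite permE leqnn /=; have [_ _ h] := fP i.
  apply: leq_trans mi; apply: h => // x xi fx.
  case/existsP: nex; exists (Ordinal (ltn_trans xi (ltn_ord i))).
  by rewrite /= xi fx /=.
- rewrite !permE /=.
  have le_ij : i <= j by rewrite ij.
  have f_ij := f_min i j le_ij; have m_fi := f_ge i i (leqnn i).
  have [/andP[m_fj _] _ f_fresh] := fP j; apply/idP/idP => lt_ji.
    by lia.
  (* All values before [j] are at least [m i > m j], so [m j] is free at step [j]. *)
  suff : f j <= m j by lia.
  apply: f_fresh => // x xj e; have := f_ge x i; rewrite -ltnS -ij xj e.
  by move/(_ isT); lia.
Qed.

(** * Characterisation of the descent sets of 132-avoiding involutions *)

Lemma card_ord_ltn n k : k <= n -> #|[set i : 'I_n | i < k]| = k.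
Proof.
by move=> kn; rewrite -sum1dep_card -(big_ord_widen n (fun=> 1)) // sum1_card card_ord.
Qed.

(** Pigeonhole: [i + 1] positions and [n - i + 1] values cannot be disjoint among [n + 1] points. *)
Lemma below_antidiagonal n (s : 'S_n.+1) (i : 'I_n.+1) : below s i (n - i).
Proof.
apply: contraT => /existsPn h.
set X := [set j : 'I_n.+1 | j < i.+1].
set Y := [set j : 'I_n.+1 | j < (n - i).+1].
have cX : #|X| = i.+1 by apply: card_ord_ltn.
have cY : #|s @^-1: Y| = (n - i).+1.
  rewrite on_card_preimset; first by apply: card_ord_ltn; lia.
  by apply: onW_bij; exists (s^-1)%g; [apply: permK | apply: permKV].
have XY0 : X :&: s @^-1: Y = set0.
  by apply/setP => j; rewrite !inE !ltnS; apply/negbTE/h.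
have := cardsUI X (s @^-1: Y); rewrite XY0 cards0 cX cY.
have := subset_leq_card (subsetT (X :|: s @^-1: Y)); rewrite cardsT card_ord.
by have := ltn_ord i; lia.
Qed.

(** Equivalently, for every [i] the first [i] indices contain at least as many elements of [D] as
    the last [i]. *)
Definition ballot n : {set {set 'I_n}} :=
  [set D : {set 'I_n} |
    [forall i : 'I_n.+1, #|D| <= cnt D i + cnt D (n - i)]].

Lemma invol132P n (s : 'S_n) :
  reflect (involutive s /\ avoids s p132) (s \in invol_avoiding n p132).
Proof. by rewrite inE; apply: (iffP andP) => -[/involP]. Qed.

Lemma desc_ballot n (s : 'S_n.+1) :
  s \in invol_avoiding n.+1 p132 -> desc s \in ballot n.
Proof.
move=> /invol132P[sK sA]; rewrite inE; apply/forallP => i.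
by rewrite -below_invol132 // below_antidiagonal.
Qed.

Lemma desc_inj n : {in invol_avoiding n.+1 p132 &, injective (@desc n)}.
Proof.
move=> s t /invol132P[sK sA] /invol132P[tK tA] eq_d.
by apply: avoids132_below_inj => // i v; rewrite !below_invol132 // eq_d.
Qed.

Lemma leq_cnt n (D : {set 'I_n}) i j : i <= j -> cnt D i <= cnt D j.
Proof.
move=> ij; apply/subset_leq_card/subsetP => x; rewrite !inE => /andP[-> xi].
exact: leq_trans ij.
Qed.

Lemma cnt0 n (D : {set 'I_n}) : cnt D 0 = 0.
Proof. by apply/eqP; rewrite cards_eq0; apply/eqP/setP => x; rewrite !inE andbF. Qed.

Lemma cntS n (D : {set 'I_n}) (i : 'I_n) : cnt D i.+1 = cnt D i + (i \in D).
Proof.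
rewrite /cnt (cardsD1 i) inE ltnSn andbT addnC; congr (_ + _).
apply: eq_card => x; rewrite !inE ltnS [x <= i]leq_eqVlt val_eqE.
by case: eqP => [->|_] //=; rewrite ltnn andbF.
Qed.

Lemma cntS_le n (D : {set 'I_n}) i : cnt D i.+1 <= (cnt D i).+1.
Proof.
have [lt_in|le_ni] := ltnP i n; last by rewrite !cnt_full //; lia.
by have := cntS D (Ordinal lt_in) => /= ->; rewrite -addn1 leq_add2l leq_b1.
Qed.

(** The inequality for [D] prescribes prefix minima [m], which the greedy permutation realises; its
    descents are the drops of [m]. *)
Lemma desc_surj n (D : {set 'I_n}) :
  D \in ballot n -> exists2 s, s \in invol_avoiding n.+1 p132 & desc s = D.
Proof.
rewrite inE => /forallP Dbal.
have exv i : exists v, #|D| <= cnt D i + cnt D v.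
  by exists n; rewrite (cnt_full D (leqnn n)) leq_addl.
pose m i := ex_minn (exv i).
have mP i v : (m i <= v) = (#|D| <= cnt D i + cnt D v).
  rewrite /m; case: ex_minnP => w hw wmin; apply/idP/idP => [wv|/wmin //].
  by apply: leq_trans hw _; rewrite leq_add2l leq_cnt.
have m_anti i j : i <= j -> m j <= m i.
  move=> ij; rewrite mP; apply: (@leq_trans (cnt D i + cnt D (m i))).
    by rewrite -mP.
  by rewrite leq_add2r leq_cnt.
have m_bound i : i < n.+1 -> i + m i < n.+1.
  move=> lt_in; have : m i <= n - i by rewrite mP (Dbal (Ordinal lt_in)).
  by lia.
have [s [sA s_below s_desc]] := prefix_min_perm m_anti m_bound.
(* The inequality defining [m] is symmetric in [i] and [v], so [s] and its inverse have the same
   prefix minima. *)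
have sV : s^-1%g = s.
  apply: avoids132_below_inj => // [|i v]; first exact: avoids132_inv.
  by rewrite below_inv !s_below !mP addnC.
exists s.
  by apply/invol132P; split=> // x; rewrite -{1}sV permK.
apply/setP => i; rewrite inE s_desc //=.
rewrite /bump /= add1n; have := cntS D i.
case: (boolP (i \in D)) => iD; rewrite ?addn1 ?addn0 => ci.
  (* For [i] in [D], [m i] is positive; passing to [i + 1] gains one in the count, which pays for
     lowering [m i] by one. *)
  have : ~~ (m i <= 0).
    rewrite mP cnt0 addn0 -ltnNge -ci -(cnt_full D (leqnn n)).
    exact: leq_cnt.
  have := mP i (m i); case: (m i) => // w; rewrite leqnn => /esym le_w _.
  rewrite ltnS mP ci addSnnS; apply: leq_trans le_w _.
  by rewrite leq_add2l cntS_le.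
by apply/negbTE; rewrite -leqNgt mP -ci -mP.
Qed.

(** * Reversal and complement of descent sets *)

Definition flip n (D : {set 'I_n}) : {set 'I_n} := [set i | rev_ord i \notin D].

Lemma flipK n : involutive (@flip n).
Proof. by move=> D; apply/setP => i; rewrite !inE negbK rev_ordK. Qed.

Lemma cnt_flip n (D : {set 'I_n}) i :
  i <= n -> cnt (flip D) i + #|D| = i + cnt D (n - i).
Proof.
elim: i => [_|i IH lt_in]; first by rewrite cnt0 subn0 cnt_full.
have := IH (ltnW lt_in); pose j := Ordinal lt_in.
have := cntS (flip D) j; have := cntS D (rev_ord j); rewrite inE /= subnSK //.
by case: (_ \in D) => /=; lia.
Qed.

(** Reversal turns the comparison of the first and last [i] indices around, and complement turns it
    back. *)
Lemma flip_ballot n (D : {set 'I_n}) : (flip D \in ballot n) = (D \in ballot n).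
Proof.
suff H E : E \in ballot n -> flip E \in ballot n.
  by apply/idP/idP => /H //; rewrite flipK.
rewrite !inE => /forallP Ebal; apply/forallP => i.
have := Ebal i; have le_in : i <= n by rewrite -ltnS.
have := cnt_flip E le_in; have := cnt_flip E (leq_subr i n).
have := cnt_flip E (leqnn n); rewrite subnn cnt0 subKn // cnt_full //.
by lia.
Qed.

Lemma sum_desc_invol132 (R : nmodType) n (F : {set 'I_n} -> R) :
  (\sum_(s in invol_avoiding n.+1 p132) F (desc s) = \sum_(D in ballot n) F D)%R.
Proof.
have -> : ballot n = (@desc n) @: invol_avoiding n.+1 p132.
  apply/setP => D; apply/idP/imsetP => [/desc_surj[s sI <-]|[s sI ->]].
    by exists s.
  exact: desc_ballot.
by rewrite big_imset //; apply: desc_inj.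
Qed.

(** * Major index under reverse-complement *)

Lemma maj_desc n (s : 'S_n.+1) : maj s = \sum_(i in desc s) i.+1.
Proof.
rewrite /maj; pose w := widen_ord (leqnSn n).
have w_inj : injective w by move=> i j /(congr1 val) /= /val_inj.
have -> : Des s = w @: desc s.
  apply/setP => i; rewrite inE; apply/existsP/imsetP => [[j /andP[/eqP ij sji]]|].
    have lt_in : i < n by have := ltn_ord j; lia.
    exists (Ordinal lt_in); last exact: val_inj.
    rewrite inE; move: sji; congr (s _ < s _); last exact: val_inj.
    by apply: val_inj.
  case=> j jD ->; exists (lift ord0 j); rewrite eqxx /=.
  by rewrite inE in jD.
by rewrite big_imset // => i j _ _; apply: w_inj.
Qed.

Lemma revcomp_subproof n (s : 'S_n) :
  injective (fun i => rev_ord (s (rev_ord i))).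
Proof. by move=> i j /rev_ord_inj /perm_inj /rev_ord_inj. Qed.

Definition revcomp n (s : 'S_n) : 'S_n := perm (@revcomp_subproof n s).

Lemma revcompE n (s : 'S_n) i : revcomp s i = rev_ord (s (rev_ord i)).
Proof. by rewrite permE. Qed.

Lemma revcompK n : involutive (@revcomp n).
Proof. by move=> s; apply/permP => i; rewrite !revcompE !rev_ordK. Qed.

Lemma ltn_rev_ord n (i j : 'I_n) : (rev_ord i < rev_ord j) = (j < i).
Proof. by rewrite /=; have := ltn_ord i; have := ltn_ord j; lia. Qed.

Lemma revcomp_invol n (s : 'S_n) : involutive s -> involutive (revcomp s).
Proof. by move=> sK i; rewrite !revcompE rev_ordK sK rev_ordK. Qed.

Lemma revcomp_avoids n (s : 'S_n) : avoids (revcomp s) p213 = avoids s p132.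
Proof.
apply/avoids213P/avoids132P => h a b c ab bc.
  move=> ac cb; apply: (h (rev_ord c) (rev_ord b) (rev_ord a));
  by rewrite ?revcompE ?rev_ordK ltn_rev_ord.
rewrite !revcompE !ltn_rev_ord => ab' ca.
by apply: (h (rev_ord c) (rev_ord b) (rev_ord a)); rewrite ?ltn_rev_ord.
Qed.

Lemma revcomp_invol_avoiding n (s : 'S_n) :
  (revcomp s \in invol_avoiding n p213) = (s \in invol_avoiding n p132).
Proof.
rewrite !inE revcomp_avoids; congr (_ && _).
apply/involP/involP => [/revcomp_invol|]; last exact: revcomp_invol.
by rewrite revcompK.
Qed.

Lemma desc_revcomp n (s : 'S_n.+1) i :
  (rev_ord i \in desc (revcomp s)) = (i \in desc s).
Proof.
rewrite !inE !revcompE ltn_rev_ord; congr (s _ < s _); apply: val_inj => /=;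
by rewrite /bump /=; have := ltn_ord i; lia.
Qed.

Lemma maj_revcomp n (s : 'S_n.+1) :
  maj (revcomp s) = \sum_(i in desc s) (rev_ord i).+1.
Proof.
rewrite maj_desc (reindex_inj rev_ord_inj) /=.
by apply: eq_bigl => i; rewrite desc_revcomp.
Qed.

(** Reindexed by [rev_ord], the first sum runs over the complement of [D], so both together give
    [1 + ... + n]. *)
Lemma sum_flip_rev n (D : {set 'I_n}) :
  \sum_(i in flip D) (rev_ord i).+1 + \sum_(i in D) i.+1 = 'C(n.+1, 2).
Proof.
rewrite -bin2_sum big_nat_recl // big_mkord add0n addnC.
rewrite [RHS](bigID (mem D)) /=; congr (_ + _).
rewrite (reindex_inj rev_ord_inj) /=.
apply: eq_big => i; first by rewrite inE rev_ordK.
by have := ltn_ord i; lia.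
Qed.

(** * Comparison of the generating functions *)

Lemma qX_neq0 k : (q ^+ k != 0)%R.
Proof. by rewrite expf_neq0 // tofrac_eq0 polyX_eq0. Qed.

Lemma perm_ord0 (s : 'S_0) : s = 1%g.
Proof. by apply/permP => -[]. Qed.

Local Open Scope ring_scope.

Theorem theorem4p14 (n : nat) :
  \sum_(s in invol_avoiding n p213) q ^+ maj s =
  q ^+ 'C(n, 2) * \sum_(s in invol_avoiding n p132) q ^- maj s.
Proof.
rewrite (reindex_inj (inv_inj (@revcompK n))) /=.
rewrite (eq_bigl _ _ (@revcomp_invol_avoiding n)) big_distrr /=.
(* [desc] presupposes at least one letter, so the empty permutation is treated apart. *)
case: n => [|n].
  apply: eq_bigr => s _; rewrite (perm_ord0 (revcomp s)) (perm_ord0 s).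
  have -> : maj (1%g : 'S_0) = 0%N by rewrite /maj big1 // => -[].
  by rewrite !expr0 invr1 mulr1.
under eq_bigr => s _ do rewrite maj_revcomp.
under [RHS]eq_bigr => s _ do rewrite maj_desc.
rewrite (sum_desc_invol132 (fun D => q ^+ (\sum_(i in D) (rev_ord i).+1)%N)).
rewrite (sum_desc_invol132 (fun D => q ^+ 'C(n.+1, 2) / q ^+ (\sum_(i in D) i.+1)%N)).
(* Pairing [flip D] on the left with [D] on the right makes the sums agree term by term. *)
rewrite (reindex_inj (inv_inj (@flipK n))) /=.
apply: eq_big => D; first exact: flip_ballot.
by rewrite -(sum_flip_rev D) exprD mulfK ?qX_neq0.
Qed.
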